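(* Let $\mathcal{P}=(\{\mathcal{E}_k:k\in K\},\{M_0,M_1\})$ be a concurrent quantum program on a Hilbert space $\mathcal{H}$ of finite dimension $d$ with orthonormal basis $\{|j\rangle\}_{j=1}^d$, and let $\rho_0$ be an initial density operator. Let $G$ be the matrix representation of the super-operator $\mathcal{G}=\frac{1}{|K|}\sum_{k\in K}\mathcal{F}_k$. Then the $d^2\times d^2$ matrix $I-G/2$ is invertible; putting $|x\rangle=(I-G/2)^{-1}(\rho_0\otimes I)|\Phi\rangle$ and $|y_j\rangle=(I\otimes\langle j|)|x\rangle\in\mathcal{H}$ for $j=1,\dots,d$, we have $\operatorname{span}\{|y_1\rangle,\dots,|y_d\rangle\}=\mathcal{H}_R$. In fact $|x\rangle=(\rho\otimes I)|\Phi\rangle$ with $\rho=\sum_{i=0}^\infty 2^{-i}\mathcal{G}^i(\rho_0)$ (a convergent series) and $\mathcal{H}_R=\operatorname{supp}(\rho)$.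
   Context: $\mathcal{H}$ is a complex Hilbert space of finite dimension $d\ge 1$. A super-operator on $\mathcal{H}$ is a completely positive linear map $\mathcal{E}$ on the space of linear operators on $\mathcal{H}$ with $\operatorname{tr}\mathcal{E}(\rho)\le\operatorname{tr}\rho$ for all positive $\rho$; every super-operator has a Kraus representation $\mathcal{E}(\rho)=\sum_i E_i\rho E_i^\dagger$. Its matrix representation (w.r.t. the basis $\{|j\rangle\}$) is the $d^2\times d^2$ matrix $\sum_i E_i\otimes E_i^*$, where $E^*$ is the entrywise complex conjugate. $|\Phi\rangle=\sum_{j=1}^d|j\rangle|j\rangle\in\mathcal{H}\otimes\mathcal{H}$. For positive semidefinite $\rho$, $\operatorname{supp}(\rho)$ is the span of eigenvectors with nonzero eigenvalues. A concurrent quantum program is a pair $\mathcal{P}=(\{\mathcal{E}_k:k\in K\},\{M_0,M_1\})$ with $K=\{1,\dots,m\}$, each $\mathcal{E}_k$ a trace-preserving super-operator on $\mathcal{H}$, and $M_0^\dagger M_0+M_1^\dagger M_1=I$. Define $\mathcal{F}_k(\rho)=\mathcal{E}_k(M_1\rho M_1^\dagger)$; for a finite string $f=s_1\cdots s_n$ over $K$, $\mathcal{F}_f=\mathcal{F}_{s_n}\circ\cdots\circ\mathcal{F}_{s_1}$ (identity for the empty string). The reachable space is $\mathcal{H}_R=\bigvee_{f\in K^*}\operatorname{supp}\mathcal{F}_f(\rho_0)$ (span of the union). *)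

(* Defs.v *)
From HB Require Import structures.
From mathcomp Require Import all_boot all_order all_algebra.
Set Implicit Arguments. Unset Strict Implicit. Unset Printing Implicit Defensive.
Import Order.TTheory GRing.Theory Num.Theory.
Local Open Scope ring_scope.

Section QDefs.
Variable C : numClosedFieldType.

Definition adj m n (A : 'M[C]_(m, n)) : 'M[C]_(n, m) := (map_mx Num.conj A)^T.

Definition mconj m n (A : 'M[C]_(m, n)) : 'M[C]_(m, n) := map_mx Num.conj A.

(* pair index decoding for the tensor product basis |i>|j> <-> mxvec_index i j *)
Definition idx_pair m n (p : 'I_(m * n)) : 'I_m * 'I_n :=
  enum_val (cast_ord (esym (mxvec_cast m n)) p).

Definition kron m1 n1 m2 n2 (A : 'M[C]_(m1, n1)) (B : 'M[C]_(m2, n2))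
  : 'M[C]_(m1 * m2, n1 * n2) :=
  \matrix_(p, q) (A (idx_pair p).1 (idx_pair q).1 * B (idx_pair p).2 (idx_pair q).2).

Definition ket d (j : 'I_d) : 'cV[C]_d := delta_mx j 0.
Definition bra d (j : 'I_d) : 'rV[C]_d := delta_mx 0 j.

Definition Phi d : 'cV[C]_(d * d) :=
  castmx (erefl, muln1 1) (\sum_(j < d) kron (ket j) (ket j)).

Definition psd d (A : 'M[C]_d) : Prop :=
  adj A = A /\ forall v : 'cV[C]_d, 0 <= (adj v *m A *m v) 0 0.
Definition density d (A : 'M[C]_d) : Prop := psd A /\ \tr A = 1.

(* a super-operator given by a (finite) Kraus representation *)
Definition apply_kraus d (ks : seq 'M[C]_d) (X : 'M[C]_d) : 'M[C]_d :=
  \sum_(E <- ks) E *m X *m adj E.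
Definition trace_preserving d (ks : seq 'M[C]_d) : Prop :=
  \sum_(E <- ks) adj E *m E = 1%:M.
Definition mrep d (ks : seq 'M[C]_d) : 'M[C]_(d * d) :=
  \sum_(E <- ks) kron E (mconj E).

Definition lspan d (S : 'cV[C]_d -> Prop) (v : 'cV[C]_d) : Prop :=
  exists (n : nat) (c : 'I_n -> C) (w : 'I_n -> 'cV[C]_d),
    (forall i, S (w i)) /\ v = \sum_(i < n) c i *: w i.

Definition supp d (A : 'M[C]_d) : 'cV[C]_d -> Prop :=
  lspan (fun v => v != 0 /\ exists lam : C, lam != 0 /\ A *m v = lam *: v).

Variables (d m : nat) (Ek : 'I_m -> seq 'M[C]_d) (M1 : 'M[C]_d).

(* Kraus operators of F_k(rho) = E_k(M1 rho M1^dagger) *)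
Definition Fkraus (k : 'I_m) : seq 'M[C]_d := [seq E *m M1 | E <- Ek k].
Definition Fk (k : 'I_m) (X : 'M[C]_d) : 'M[C]_d := apply_kraus (Ek k) (M1 *m X *m adj M1).
Definition Fstr (f : seq 'I_m) (X : 'M[C]_d) : 'M[C]_d := foldl (fun Y k => Fk k Y) X f.
Definition Gmap (X : 'M[C]_d) : 'M[C]_d := (m%:R)^-1 *: \sum_(k < m) Fk k X.
Definition Gmat : 'M[C]_(d * d) := (m%:R)^-1 *: \sum_(k < m) mrep (Fkraus k).

Definition reach (rho0 : 'M[C]_d) : 'cV[C]_d -> Prop :=
  lspan (fun v => exists f : seq 'I_m, supp (Fstr f rho0) v).

Definition Gseries (rho0 : 'M[C]_d) (n : nat) : 'M[C]_d :=
  \sum_(i < n.+1) (2%:R^-1) ^+ i *: iter i Gmap rho0.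

End QDefs.

Definition mx_converges (C : numClosedFieldType) p q (S : nat -> 'M[C]_(p, q))
  (L : 'M[C]_(p, q)) : Prop :=
  forall eps : C, 0 < eps -> exists N : nat, forall n : nat, (N <= n)%N ->
    forall i j, `|S n i j - L i j| < eps.

(* Main.v *)
Require Import Defs.
From HB Require Import structures.
From mathcomp Require Import all_boot all_order all_algebra.
From mathcomp Require Import ring.
Set Implicit Arguments. Unset Strict Implicit. Unset Printing Implicit Defensive.
Import Order.TTheory GRing.Theory Num.Theory.
Local Open Scope ring_scope.

(** Vectorization [X |-> (X (x) I) |Phi>] turns the matrix [G] into the
    map [Gmap].  A positive trace-nonincreasing map has bounded orbits: a positive
    semidefinite matrix has entries at most its trace, and by polarization such
    matrices span.  Hence [G X = 2 X] forces [X = 0], so [I - G/2] is invertible,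
    and the remainder [2^-(n+1) G^(n+1) rho] of the series of [rho], the solution of
    [rho = rho0 + G rho / 2], tends to zero.  The limit [rho] is positive
    semidefinite and dominates each partial sum, so a vector killed by [rho] is
    killed by all [F_f rho0], which gives [H_R <= range rho]; conversely, by
    Cayley-Hamilton [rho] is a finite linear combination of the [F_f rho0]. *)

(** * Conjugate transposes *)

Section Adjoint.
Variable C : numClosedFieldType.

Lemma mxDE m n (A B : 'M[C]_(m, n)) i j : (A + B) i j = A i j + B i j.
Proof. exact: mxE. Qed.

Lemma mxBE m n (A B : 'M[C]_(m, n)) i j : (A - B) i j = A i j - B i j.
Proof. by rewrite !mxE. Qed.

Lemma mxZE m n a (A : 'M[C]_(m, n)) i j : (a *: A) i j = a * A i j.
Proof. exact: mxE. Qed.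

Lemma adjE m n (A : 'M[C]_(m, n)) i j : adj A i j = (A j i)^*.
Proof. by rewrite !mxE. Qed.

Lemma adjK m n (A : 'M[C]_(m, n)) : adj (adj A) = A.
Proof. by apply/matrixP=> i j; rewrite !adjE conjCK. Qed.

Lemma adjM m n p (A : 'M[C]_(m, n)) (B : 'M[C]_(n, p)) :
  adj (A *m B) = adj B *m adj A.
Proof. by rewrite /adj map_mxM trmx_mul. Qed.

Lemma adjD m n (A B : 'M[C]_(m, n)) : adj (A + B) = adj A + adj B.
Proof. by rewrite /adj map_mxD linearD. Qed.

Lemma adjB m n (A B : 'M[C]_(m, n)) : adj (A - B) = adj A - adj B.
Proof. by rewrite /adj map_mxB linearB. Qed.

Lemma adj_scale m n a (A : 'M[C]_(m, n)) : adj (a *: A) = a^* *: adj A.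
Proof. by apply/matrixP=> i j; rewrite !(adjE, mxE) rmorphM. Qed.

Lemma adj0 m n : adj (0 : 'M[C]_(m, n)) = 0.
Proof. by apply/matrixP=> i j; rewrite !(adjE, mxE) rmorph0. Qed.

Lemma adj_sum m n I (r : seq I) (P : pred I) (F : I -> 'M[C]_(m, n)) :
  adj (\sum_(i <- r | P i) F i) = \sum_(i <- r | P i) adj (F i).
Proof. exact: (big_morph _ (@adjD m n) (adj0 m n)). Qed.

Lemma adj_mul_ge0 n (v : 'cV[C]_n) : 0 <= (adj v *m v) 0 0.
Proof.
rewrite mxE sumr_ge0 // => i _.
by rewrite adjE mulrC -normCK exprn_ge0.
Qed.

Lemma adj_mul_eq0 n (v : 'cV[C]_n) : (adj v *m v) 0 0 = 0 -> v = 0.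
Proof.
move=> v0; apply/colP=> i; rewrite [RHS]mxE.
have := v0; rewrite mxE => /psumr_eq0P h.
have /eqP : adj v 0 i * v i 0 = 0.
  by apply: h => // j _; rewrite adjE mulrC -normCK exprn_ge0.
by rewrite adjE mulf_eq0 conjC_eq0 orbb => /eqP.
Qed.

End Adjoint.

(** * Linear spans of predicates on column vectors *)

Section Span.
Variables (C : numClosedFieldType) (d : nat).
Implicit Type S : 'cV[C]_d -> Prop.

Lemma lspan_mem S v : S v -> lspan S v.
Proof.
move=> Sv; exists 1, (fun _ => 1), (fun _ => v); split=> //.
by rewrite big_ord1 scale1r.
Qed.

Lemma lspan0 S : lspan S 0.
Proof.
by exists 0, (fun _ => 0), (fun _ => 0); split=> [[]|] //; rewrite big_ord0.
Qed.

Lemma lspanZ S a v : lspan S v -> lspan S (a *: v).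
Proof.
move=> [n [c [w [Sw ->]]]]; exists n, (fun i => a * c i), w; split=> //.
by rewrite scaler_sumr; apply: eq_bigr => i _; rewrite scalerA.
Qed.

Lemma lspanD S u v : lspan S u -> lspan S v -> lspan S (u + v).
Proof.
move=> [n [c [w [Sw ->]]]] [n' [c' [w' [Sw' ->]]]].
exists (n + n')%N.
exists (fun i => match split i with inl j => c j | inr j => c' j end).
exists (fun i => match split i with inl j => w j | inr j => w' j end).
split=> [i|]; first by case: split.
rewrite big_split_ord /=; congr (_ + _); apply: eq_bigr => i _.
- by rewrite (unsplitK (inl i : 'I_n + 'I_n')).
- by rewrite (unsplitK (inr i : 'I_n + 'I_n')).
Qed.

Lemma lspan_sum S I (r : seq I) (P : pred I) (F : I -> 'cV[C]_d) :
  (forall i, P i -> lspan S (F i)) -> lspan S (\sum_(i <- r | P i) F i).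
Proof. by move=> h; apply: big_ind => //; [exact: lspan0 | exact: lspanD]. Qed.

Lemma lspan_ind S (P : 'cV[C]_d -> Prop) :
    P 0 -> (forall a u, P u -> P (a *: u)) ->
    (forall u v, P u -> P v -> P (u + v)) -> (forall u, S u -> P u) ->
  forall v, lspan S v -> P v.
Proof.
move=> P0 PZ PD PS v [n [c [w [Sw ->]]]].
by apply: big_ind => // i _; apply/PZ/PS.
Qed.

Lemma lspan_sub S S' v :
  (forall u, S u -> lspan S' u) -> lspan S v -> lspan S' v.
Proof.
move=> h; apply: lspan_ind => //; first exact: lspan0.
- by move=> *; apply: lspanZ.
- by move=> *; apply: lspanD.
Qed.

Lemma lspan_range S n (A : 'M[C]_(d, n)) v :
    (forall u, S u -> exists w, u = A *m w) ->
  lspan S v -> exists w, v = A *m w.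
Proof.
move=> SA; apply: (lspan_ind (P := fun v => exists w, v = A *m w)) => //.
- by exists 0; rewrite mulmx0.
- by move=> a _ [u ->]; exists (a *: u); rewrite scalemxAr.
- by move=> _ _ [u1 ->] [u2 ->]; exists (u1 + u2); rewrite mulmxDr.
Qed.

End Span.

(** * Quadratic forms and positive semidefinite matrices *)

Section Psd.
Variables (C : numClosedFieldType) (d : nat).
Implicit Types (A B P : 'M[C]_d) (u v : 'cV[C]_d).

Definition qform A v : C := (adj v *m A *m v) 0 0.

Lemma qformD A B v : qform (A + B) v = qform A v + qform B v.
Proof. by rewrite /qform mulmxDr mulmxDl mxE. Qed.

Lemma qformZ a A v : qform (a *: A) v = a * qform A v.
Proof. by rewrite /qform -scalemxAr -scalemxAl mxE. Qed.

Lemma qform0 v : qform 0 v = 0.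
Proof. by rewrite /qform mulmx0 mul0mx mxE. Qed.

Lemma qform_sum I (r : seq I) (Q : pred I) (F : I -> 'M[C]_d) v :
  qform (\sum_(i <- r | Q i) F i) v = \sum_(i <- r | Q i) qform (F i) v.
Proof.
exact: (big_morph (fun A => qform A v) (fun A B => qformD A B v) (qform0 v)).
Qed.

Lemma qformE A v : qform A v = \sum_i \sum_j (v i 0)^* * A i j * v j 0.
Proof.
rewrite /qform mxE exchange_big /=; apply: eq_bigr => j _.
by rewrite mxE mulr_suml; apply: eq_bigr => i _; rewrite adjE.
Qed.

Lemma psd_qform A v : psd A -> 0 <= qform A v.
Proof. by move=> [_]; apply. Qed.

Lemma psd0 : psd (0 : 'M[C]_d).
Proof. by split=> [|v]; rewrite ?adj0 // mulmx0 mul0mx mxE. Qed.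

Lemma psdD A B : psd A -> psd B -> psd (A + B).
Proof.
move=> [hA pA] [hB pB]; split=> [|v]; first by rewrite adjD hA hB.
by rewrite -/(qform _ _) qformD addr_ge0 ?pA ?pB.
Qed.

Lemma psdZ a A : 0 <= a -> psd A -> psd (a *: A).
Proof.
move=> a0 [hA pA]; split=> [|v]; first by rewrite adj_scale hA geC0_conj.
by rewrite -/(qform _ _) qformZ mulr_ge0 ?pA.
Qed.

Lemma psd_sum I (r : seq I) (Q : pred I) (F : I -> 'M[C]_d) :
  (forall i, Q i -> psd (F i)) -> psd (\sum_(i <- r | Q i) F i).
Proof. by move=> h; apply: big_ind => //; [exact: psd0 | exact: psdD]. Qed.

Lemma psd_congr (E A : 'M[C]_d) : psd A -> psd (E *m A *m adj E).
Proof.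
move=> [hA pA]; split=> [|v]; first by rewrite !adjM adjK hA mulmxA.
by have := pA (adj E *m v); rewrite adjM adjK !mulmxA.
Qed.

Lemma psd_rank1 u : psd (u *m adj u).
Proof.
split=> [|v]; first by rewrite adjM adjK.
by have := adj_mul_ge0 (adj u *m v); rewrite adjM adjK !mulmxA.
Qed.

(** Test vectors supported on two coordinates expose single entries of [A]: [c = 0] isolates the
    diagonal, and a phase [c] controls the off-diagonal pair. *)
Lemma qform_ket2 A i j c :
  qform A (ket C i + c *: ket C j) =
  A i i + c * A i j + c^* * A j i + c * c^* * A j j.
Proof.
have e k l : (adj (ket C k) *m A *m ket C l) 0 0 = A k l.
  rewrite mxE (bigD1 l) //= big1 => [|n /negPf nl]; last first.
    by rewrite !mxE nl mulr0.
  rewrite !mxE !eqxx mulr1 addr0 (bigD1 k) //= big1 => [|n /negPf nk].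
    by rewrite !mxE !eqxx rmorph1 mul1r addr0.
  by rewrite !mxE nk rmorph0 mul0r.
rewrite /qform adjD adj_scale !mulmxDl !mulmxDr -!scalemxAl -!scalemxAr.
rewrite !mxDE !mxZE !e.
ring.
Qed.

Lemma psd_diag_ge0 A i : psd A -> 0 <= A i i.
Proof.
move=> /psd_qform - /(_ (ket C i + 0 *: ket C i)).
by rewrite qform_ket2 rmorph0 !mul0r !addr0.
Qed.

Lemma psd_diag_le_tr A i : psd A -> A i i <= \tr A.
Proof.
move=> pA; rewrite /mxtrace (bigD1 i) //= lerDl sumr_ge0 // => j _.
exact: psd_diag_ge0.
Qed.

Lemma psd_tr_ge0 A : psd A -> 0 <= \tr A.
Proof. by move=> pA; apply: sumr_ge0 => i _; apply: psd_diag_ge0. Qed.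

(** Testing the form on [ket i + c ket j] with a suitable phase gives [2 |A i j| <= A i i + A j j].
    Each diagonal entry is at most the trace, so [i = j] needs no separate case. *)
Lemma psd_norm_le_tr A i j : psd A -> `|A i j| <= \tr A.
Proof.
move=> pA; have [->|nz] := eqVneq (A i j) 0.
  by rewrite normr0 psd_tr_ge0.
have hji : A j i = (A i j)^* by have [hA _] := pA; rewrite -[in LHS]hA adjE.
have nn : `|A i j| != 0 by rewrite normr_eq0.
(* This phase turns both cross terms into [- |A i j|]. *)
set c := - (A i j)^* / `|A i j|.
have cA : c * A i j = - `|A i j|.
  rewrite /c mulrAC mulNr (mulrC _^*) -normCK expr2 mulNr mulfK //.
have cA' : c^* * A j i = - `|A i j|.
  by rewrite hji -rmorphM cA rmorphN /= geC0_conj.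
have cc : c * c^* = 1.
  rewrite -normCK /c normrM normrN norm_conjC normfV normr_id divff //.
  by rewrite expr1n.
have := psd_qform (ket C i + c *: ket C j) pA.
rewrite qform_ket2 cA cA' cc mul1r => h.
have h1 := psd_diag_le_tr i pA; have h2 := psd_diag_le_tr j pA.
have h3 : 2%:R * `|A i j| <= 2%:R * \tr A.
  apply: (@le_trans _ _ (A i i + A j j)).
    rewrite -subr_ge0; apply: le_trans h _; rewrite le_eqVlt; apply/orP; left.
    by apply/eqP; ring.
  by rewrite mulr_natl mulr2n lerD.
by rewrite ler_pM2l in h3.
Qed.

(* Perturbing [v] by a small multiple of [A v] would make the form negative. *)
Lemma psd_qform_eq0 A v : psd A -> qform A v = 0 -> A *m v = 0.
Proof.
move=> pA v0; have [hA _] := pA.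
set u := A *m v; set a := (adj u *m u) 0 0; set b := qform A u.
have a0 : 0 <= a by exact: adj_mul_ge0.
have b0 : 0 <= b by exact: psd_qform.
have b1 : 0 < b + 1 by rewrite ltr_wpDl.
have uE : adj v *m A = adj u by rewrite /u adjM hA.
have e s : s^* = s -> qform A (v - s *: u) = s * (s * b - 2%:R * a).
  move=> sr; rewrite /qform adjB adj_scale sr !mulmxBl !mulmxBr -!scalemxAl.
  rewrite -!scalemxAr !mxBE !mxZE -/(qform A v) v0 -/(qform A u) -/b.
  rewrite uE -[adj u *m A *m v]mulmxA -/u -/a.
  ring.
(* The step [s = a / (b + 1)] makes [s b < a] whenever [a > 0], so that [s (s b - 2 a)] is negative;
   the [+ 1] covers [b = 0]. *)
have s0 : 0 <= a / (b + 1) by rewrite divr_ge0 // ltW.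
have := psd_qform (v - (a / (b + 1)) *: u) pA.
rewrite e ?geC0_conj // => h.
apply: adj_mul_eq0; rewrite -/a; apply/eqP; apply/negPn/negP => an.
have ap : 0 < a by rewrite lt0r an.
rewrite pmulr_rge0 ?divr_gt0 // subr_ge0 in h.
have : a * b / (b + 1) < a.
  by rewrite ltr_pdivrMr // ltr_pM2l // ltrDl.
rewrite mulrAC => h'; have := le_lt_trans h h'.
by rewrite mulr_natl mulr2n gtrDl (le_gtF a0).
Qed.

End Psd.

(** An eigenvector [w] with eigenvalue [lam != 0] is [A (lam^-1 w)]. Conversely, the spectral
    theorem expands [u] in eigenvectors, and [A] kills those of eigenvalue zero while scaling the
    others. Ranges are easier to compare than supports. *)
Lemma supp_range (C : numClosedFieldType) d (A : 'M[C]_d) v :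
  adj A = A -> supp A v <-> exists u, v = A *m u.
Proof.
move=> hA; split=> [|[u ->]].
  apply: lspan_range => w [_ [lam [lam0 e]]]; exists (lam^-1 *: w).
  by rewrite -scalemxAr e scalerA mulVf // scale1r.
have /orthomx_spectralP AE : A \is normalmx.
  by apply/normalmxP; rewrite -map_trmx -/(adj A) hA.
set P := spectralmx A in AE; set D := spectral_diag A in AE.
have Pu : P \in unitmx by exact: spectral_unit.
have De i : diag_mx D *m ket C i = D 0 i *: ket C i.
  apply/colP=> j; rewrite mul_diag_mx !mxE andbT.
  by case: eqVneq => [->|_]; rewrite ?mulr0.
(* The columns of [invmx P] form the eigenbasis, and [P *m u] holds the coordinates of [u] in it. *)
have uE : u = \sum_i (P *m u) i 0 *: (invmx P *m ket C i).
  under eq_bigr do rewrite scalemxAr.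
  rewrite -mulmx_sumr -[LHS](mulKmx Pu); congr (_ *m _).
  rewrite [LHS]matrix_sum_delta; apply: eq_bigr => i _.
  by rewrite big_ord1.
have eig i : A *m (invmx P *m ket C i) = D 0 i *: (invmx P *m ket C i).
  by rewrite [in LHS]AE -!mulmxA mulKVmx // De -scalemxAr.
rewrite uE mulmx_sumr; apply: lspan_sum => i _.
rewrite -scalemxAr; apply: lspanZ; rewrite eig.
have [->|Di] := eqVneq (D 0 i) 0; first by rewrite scale0r; apply: lspan0.
apply: lspanZ; apply: lspan_mem; split; last by exists (D 0 i).
apply/eqP=> /(congr1 (mulmx P)); rewrite mulmx0 mulKVmx // => /colP/(_ i).
by rewrite !mxE !eqxx => /eqP; rewrite oner_eq0.
Qed.

(* By Cayley-Hamilton, [invmx A] is a polynomial in [A]. *)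
Lemma invmx_stable (F : fieldType) n (A : 'M[F]_n) (P : 'cV[F]_n -> Prop) :
    A \in unitmx -> P 0 -> (forall a u, P u -> P (a *: u)) ->
    (forall u v, P u -> P v -> P (u + v)) -> (forall u, P u -> P (A *m u)) ->
  forall b, P b -> P (invmx A *m b).
Proof.
case: n A P => [|n] A P Au P0 PZ PD PA b Pb.
  by rewrite (flatmx0 (_ *m _)).
have Ph p : forall u, P u -> P (horner_mx A p *m u).
  elim/poly_ind: p => [|p c IH] u Pu; first by rewrite rmorph0 mul0mx.
  rewrite rmorphD rmorphM /= horner_mx_X horner_mx_C mulmxDl mul_scalar_mx.
  by apply: (PD); [rewrite -mulmxA; apply/IH/PA | apply: PZ].
(* The constant term [c] is the determinant up to sign, hence nonzero, and [q(A) A + c = 0] gives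
   [invmx A = - c^-1 q(A)]. *)
have [q [c e]] : exists q c, char_poly A = q * 'X + c%:P.
  by elim/poly_ind: (char_poly A) => [|q c _];
    [exists 0, 0; rewrite mul0r addr0 | exists q, c].
have c0 : c != 0.
  have := char_poly_det A; rewrite e coefD coefMX coefC !eqxx add0r => ->.
  by rewrite mulf_neq0 ?signr_eq0 // -unitfE -unitmxE.
have := Cayley_Hamilton A.
rewrite e rmorphD rmorphM /= horner_mx_X horner_mx_C => /eqP.
rewrite addr_eq0 => /eqP/(congr1 (fun M => M *m (invmx A *m b))).
rewrite -[_ * A]/(_ *m A) -mulmxA mulKVmx // mulNmx mul_scalar_mx => h.
have -> : invmx A *m b = - c^-1 *: (horner_mx A q *m b).
  by rewrite h scalerN scaleNr opprK scalerA mulVf // scale1r.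
exact/PZ/Ph.
Qed.

(** * Vectorization and Kronecker products *)

Section Vectorization.
Variable C : numClosedFieldType.

Lemma idx_pairK m n (i : 'I_m) (j : 'I_n) : idx_pair (mxvec_index i j) = (i, j).
Proof. by rewrite /idx_pair /mxvec_index cast_ordK enum_rankK. Qed.

Lemma sum_idx_pair (V : nmodType) m n (F : 'I_(m * n) -> V) :
  \sum_p F p = \sum_i \sum_j F (mxvec_index i j).
Proof.
rewrite (reindex _ (curry_mxvec_bij m n)) pair_bigA /=.
by apply: eq_bigr => -[].
Qed.

(** Applying [I (x) <j|] yields a vector indexed by ['I_(d * 1)]; this reconciles the numerical cast
    to ['I_d] with the decoding of pairs, by computing the enumeration of ['I_d * 'I_1]. *)
Lemma idx_pair_muln1 d (i : 'I_d) :
  idx_pair (cast_ord (esym (muln1 d)) i) = (i, ord0).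
Proof.
rewrite /idx_pair cast_ord_comp (enum_val_nth (i, ord0)) /=.
have -> : enum {: 'I_d * 'I_1} = [seq (k, ord0) | k <- enum 'I_d].
  have -> : enum {: 'I_d * 'I_1} = prod_enum 'I_d 'I_1.
    by rewrite enumT unlock.
  have e1 : enum 'I_1 = [:: ord0].
    by apply: (inj_map val_inj); rewrite val_enum_ord.
  by rewrite /prod_enum e1; elim: (enum 'I_d) => //= k s ->.
rewrite (nth_map i) ?size_enum_ord //=; congr (_, _).
by apply: val_inj; rewrite /= nth_enum_ord.
Qed.

(** This is the row-major listing of the entries of [X], as [vecE] shows. *)
Definition vec d (X : 'M[C]_d) : 'cV[C]_(d * d) :=
  kron X (1%:M : 'M[C]_d) *m Phi C d.

Lemma PhiE d (p : 'I_(d * d)) :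
  Phi C d p 0 = ((idx_pair p).1 == (idx_pair p).2)%:R.
Proof.
rewrite /Phi castmxE cast_ord_id summxE (bigD1 (idx_pair p).1) //= big1.
  by rewrite !mxE !ord1 !eqxx !andbT mul1r addr0 eq_sym.
by move=> k kp; rewrite !mxE !ord1 !eqxx !andbT eq_sym (negPf kp) mul0r.
Qed.

Lemma vecE d (X : 'M[C]_d) p : vec X p 0 = X (idx_pair p).1 (idx_pair p).2.
Proof.
rewrite mxE sum_idx_pair (bigD1 (idx_pair p).2) //= (bigD1 (idx_pair p).2) //=.
rewrite !mxE PhiE idx_pairK /= !eqxx !mulr1 !big1 ?addr0 //.
  move=> i ip; rewrite big1 // => j _; rewrite PhiE mxE idx_pairK mxE /=.
  by case: eqVneq => [<-|_]; rewrite ?(negPf ip) !mulr0 ?mul0r.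
by move=> j jp; rewrite mxE idx_pairK mxE /= eq_sym (negPf jp) mulr0 mul0r.
Qed.

Lemma vecD d (X Y : 'M[C]_d) : vec (X + Y) = vec X + vec Y.
Proof. by apply/colP=> p; rewrite mxDE !vecE mxDE. Qed.

Lemma vecZ d a (X : 'M[C]_d) : vec (a *: X) = a *: vec X.
Proof. by apply/colP=> p; rewrite mxZE !vecE mxZE. Qed.

Lemma vec0 d : vec (0 : 'M[C]_d) = 0.
Proof. by apply/colP=> p; rewrite vecE !mxE. Qed.

Lemma vec_sum d I (r : seq I) (P : pred I) (F : I -> 'M[C]_d) :
  vec (\sum_(i <- r | P i) F i) = \sum_(i <- r | P i) vec (F i).
Proof. exact: (big_morph _ (@vecD d) (vec0 d)). Qed.

Lemma vec_inj d : injective (@vec d).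
Proof.
move=> X Y XY; apply/matrixP=> i j.
by have := congr1 (fun x : 'cV_(d * d) => x (mxvec_index i j) 0) XY;
  rewrite !vecE idx_pairK.
Qed.

Lemma vec_surj d (x : 'cV[C]_(d * d)) : exists X, x = vec X.
Proof.
exists (\matrix_(i, j) x (mxvec_index i j) 0); apply/colP=> p.
by case/mxvec_indexP: p => i j; rewrite vecE idx_pairK mxE.
Qed.

(** For row-major vectorization [A (x) B] acts as [X |-> A X B^T], and the transpose of [mconj E] is
    [adj E]. *)
Lemma kron_vec d (E X : 'M[C]_d) :
  kron E (mconj E) *m vec X = vec (E *m X *m adj E).
Proof.
apply/colP=> p; rewrite vecE mxE sum_idx_pair mxE exchange_big /=.
apply: eq_bigr => j _; rewrite mxE mulr_suml; apply: eq_bigr => i _.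
by rewrite vecE mxE !idx_pairK /= !mxE; ring.
Qed.

Lemma mrep_vec d (ks : seq 'M[C]_d) X :
  mrep ks *m vec X = vec (apply_kraus ks X).
Proof.
rewrite /mrep mulmx_suml /apply_kraus vec_sum.
by apply: eq_bigr => E _; rewrite kron_vec.
Qed.

(** Through this identity the vectors [y_j] become the columns of [rho], and their span its
    range. *)
Lemma bra_vec d (X : 'M[C]_d) j :
  castmx (muln1 d, erefl) (kron (1%:M : 'M[C]_d) (bra C j) *m vec X) = col j X.
Proof.
apply/colP=> i; rewrite castmxE cast_ord_id mxE sum_idx_pair [RHS]mxE.
rewrite (bigD1 i) //= (bigD1 j) //= vecE mxE idx_pair_muln1 idx_pairK /= !mxE.
rewrite !eqxx !mul1r !big1 ?addr0 // => [k ki|k kj].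
  rewrite big1 // => l _.
  by rewrite mxE idx_pair_muln1 idx_pairK !mxE eq_sym (negPf ki) !mul0r.
by rewrite mxE idx_pair_muln1 idx_pairK !mxE (negPf kj) andbF mulr0 mul0r.
Qed.

End Vectorization.

(** Weighting [T c] by [c] over the four fourth roots of unity cancels every term except
    [u *m adj v], whose coefficient is [c c^* = 1] each time. *)
Lemma polarization (C : numClosedFieldType) d (u v : 'cV[C]_d) :
  let T c := (u + c *: v) *m adj (u + c *: v) in
  u *m adj v =
  4%:R^-1 *: (T 1 + (-1) *: T (-1) + 'i *: T 'i + (- 'i) *: T (- 'i)).
Proof.
move=> T; have TE c : T c = u *m adj u + c^* *: (u *m adj v)
    + c *: (v *m adj u) + (c * c^*) *: (v *m adj v).
  rewrite /T adjD adj_scale mulmxDl !mulmxDr -!scalemxAl -!scalemxAr scalerA.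
  by rewrite !addrA.
rewrite !TE !rmorphN /= !rmorph1 conjCi.
move: (u *m adj u) (u *m adj v) (v *m adj u) (v *m adj v) => a b c e.
apply/matrixP=> i j; rewrite !(mxDE, mxZE).
move: (a i j) (b i j) (c i j) (e i j) => {}a {}b {}c {}e.
have i2 : 'i * 'i = -1 :> C by rewrite -expr2 sqrCi.
have n4 : 4%:R != 0 :> C by rewrite pnatr_eq0.
apply: (mulfI n4); rewrite mulrA divff // mul1r.
ring: i2.
Qed.

(** The kernel inclusion gives an inclusion of row spaces, [A = X B]; taking adjoints of these
    Hermitian matrices moves the factor to the right. *)
Lemma range_of_ker (C : numClosedFieldType) d (A B : 'M[C]_d) :
    adj A = A -> adj B = B -> (forall v : 'cV_d, B *m v = 0 -> A *m v = 0) ->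
  exists X, A = B *m X.
Proof.
move=> hA hB h.
(* The columns of [cokermx B] are killed by [B], hence by [A]. *)
have /submxP[X AX] : (A <= B)%MS.
  rewrite submxE; apply/eqP/matrixP=> i j; rewrite [RHS]mxE.
  have := h (col j (cokermx B)); rewrite !colE (mulmxA B) mulmx_coker mul0mx.
  move=> /(_ erefl); rewrite (mulmxA A) -colE => /colP/(_ i).
  by rewrite [LHS]mxE [RHS]mxE.
by exists (adj X); rewrite -[LHS]hA AX adjM hB.
Qed.

(** * The maps [F_k] and [G]: linearity, positivity, traces, bounded orbits *)

Section Program.
Variables (C : numClosedFieldType) (d m : nat).
Variables (Ek : 'I_m -> seq 'M[C]_d) (M1 : 'M[C]_d).
Local Notation F := (Fk Ek M1).
Local Notation G := (Gmap Ek M1).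
Local Notation Fs := (Fstr Ek M1).

Lemma Fk_is_linear k : linear (F k).
Proof.
move=> a X Y; rewrite /Fk /apply_kraus scaler_sumr -big_split /=.
apply: eq_bigr => E _.
by rewrite mulmxDr mulmxDl mulmxDr mulmxDl -!(scalemxAr, scalemxAl).
Qed.

HB.instance Definition _ k :=
  GRing.isLinear.Build C 'M[C]_d 'M[C]_d *:%R (F k) (Fk_is_linear k).

Lemma Gmap_is_linear : linear G.
Proof.
move=> a X Y; rewrite /Gmap scalerA mulrC -scalerA -scalerDr; congr (_ *: _).
by rewrite scaler_sumr -big_split; apply: eq_bigr => k _; rewrite linearP.
Qed.

HB.instance Definition _ :=
  GRing.isLinear.Build C 'M[C]_d 'M[C]_d *:%R G Gmap_is_linear.

Lemma iter_GmapD n X Y : iter n G (X + Y) = iter n G X + iter n G Y.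
Proof. by elim: n => //= n ->; rewrite linearD. Qed.

Lemma iter_GmapZ n a X : iter n G (a *: X) = a *: iter n G X.
Proof. by elim: n => //= n ->; rewrite linearZ. Qed.

Lemma iter_Gmap_sum n I (r : seq I) (P : pred I) (X : I -> 'M[C]_d) :
  iter n G (\sum_(i <- r | P i) X i) = \sum_(i <- r | P i) iter n G (X i).
Proof.
apply: (big_morph _ (iter_GmapD n)).
by elim: n => //= n ->; rewrite linear0.
Qed.

Lemma adj_Fk k X : adj (F k X) = F k (adj X).
Proof.
rewrite /Fk /apply_kraus adj_sum; apply: eq_bigr => E _.
by rewrite !adjM !adjK !mulmxA.
Qed.

Lemma adj_Gmap X : adj (G X) = G (adj X).
Proof.
rewrite /Gmap adj_scale adj_sum fmorphV rmorph_nat; congr (_ *: _).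
by apply: eq_bigr => k _; rewrite adj_Fk.
Qed.

Lemma psd_Fk k X : psd X -> psd (F k X).
Proof. by move=> pX; apply: psd_sum => E _; do 2!apply: psd_congr. Qed.

Lemma psd_Gmap X : psd X -> psd (G X).
Proof.
move=> pX; apply: psdZ; first by rewrite invr_ge0 ler0n.
by apply: psd_sum => k _; apply: psd_Fk.
Qed.

Lemma psd_iter_Gmap n X : psd X -> psd (iter n G X).
Proof. by move=> pX; elim: n => //= n; apply: psd_Gmap. Qed.

Lemma psd_Fstr f X : psd X -> psd (Fs f X).
Proof. by elim: f X => //= k f IH X pX; apply/IH/psd_Fk. Qed.

Lemma Fstr_rcons f k X : F k (Fs f X) = Fs (rcons f k) X.
Proof. by rewrite /Fstr foldl_rcons. Qed.

(* [G^n] is a positive multiple of the sum of the [F_f] with [|f| = n], and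
   all these terms are positive semidefinite. *)
Lemma qform_Fstr_eq0 f X v :
  psd X -> qform (iter (size f) G X) v = 0 -> qform (Fs f X) v = 0.
Proof.
(* The first letter of [f] acts first, so the innermost [G] is the one expanded, and the induction
   hypothesis is used at [F k X]. *)
elim: f X => //= k f IH X pX; rewrite -iterS iterSr {2}/Gmap iter_GmapZ qformZ.
have m0 : m%:R != 0 :> C.
  by rewrite pnatr_eq0 -lt0n; apply: leq_trans (ltn_ord k).
move/eqP; rewrite mulf_eq0 invr_eq0 (negPf m0) /=.
rewrite iter_Gmap_sum qform_sum => /eqP/psumr_eq0P h.
apply: (IH _ (psd_Fk k pX)); apply: h => // l _.
exact/psd_qform/psd_iter_Gmap/psd_Fk.
Qed.

Lemma Gmat_vec X : Gmat Ek M1 *m vec X = vec (G X).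
Proof.
rewrite /Gmat -scalemxAl mulmx_suml vecZ vec_sum; congr (_ *: _).
apply: eq_bigr => k _; rewrite mrep_vec; congr vec.
rewrite /Fk /apply_kraus big_map; apply: eq_bigr => E _.
by rewrite adjM !mulmxA.
Qed.

(** The fixed-point equation is unfolded [n.+1] times, once per term of [Gseries n]. Being exact,
    the identity serves both for convergence and for comparing [X] with its partial sums. *)
Lemma Gseries_remainder X0 X n :
  X = X0 + 2%:R^-1 *: G X ->
  X = Gseries Ek M1 X0 n + 2%:R^-1 ^+ n.+1 *: iter n.+1 G X.
Proof.
move=> XE; elim: n => [|n IH].
  by rewrite /Gseries big_ord1 expr0 scale1r expr1.
have e : iter n.+1 G X = iter n.+1 G X0 + 2%:R^-1 *: iter n.+2 G X.
  by rewrite {1}XE iter_GmapD iter_GmapZ -iterSr.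
rewrite /Gseries big_ord_recr -/(Gseries Ek M1 X0 n) [LHS]IH e scalerDr addrA.
by rewrite [2%:R^-1 ^+ n.+2]exprSr -[in RHS]scalerA.
Qed.

Variable M0 : 'M[C]_d.
Hypothesis Ek_tp : forall k, trace_preserving (Ek k).
Hypothesis M01 : adj M0 *m M0 + adj M1 *m M1 = 1%:M.
Hypothesis m_gt0 : (0 < m)%N.

Lemma tr_kraus (ks : seq 'M[C]_d) X :
  trace_preserving ks -> \tr (apply_kraus ks X) = \tr X.
Proof.
move=> tp; rewrite /apply_kraus raddf_sum /=.
under eq_bigr do rewrite mxtrace_mulC mulmxA.
by rewrite -raddf_sum /= -mulmx_suml tp mul1mx.
Qed.

(** The completeness relation splits [\tr X] into the traces of the two measurement branches; the
    [M0] branch is nonnegative and is dropped. *)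
Lemma tr_Fk_le k X : psd X -> \tr (F k X) <= \tr X.
Proof.
move=> pX; rewrite /Fk tr_kraus // -[X in _ <= \tr X]mul1mx -M01 mulmxDl.
rewrite mxtraceD mxtrace_mulC mulmxA lerDr -mulmxA mxtrace_mulC.
exact/psd_tr_ge0/psd_congr.
Qed.

Lemma tr_Gmap_le X : psd X -> \tr (G X) <= \tr X.
Proof.
move=> pX; rewrite /Gmap mxtraceZ raddf_sum /= mulrC ler_pdivrMr ?ltr0n //.
rewrite mulr_natr -[X in _ *+ X]card_ord -sumr_const.
by apply: ler_sum => k _; apply: tr_Fk_le.
Qed.

Lemma tr_iter_Gmap_le n X : psd X -> \tr (iter n G X) <= \tr X.
Proof.
move=> pX; elim: n => //= n; apply: le_trans.
exact/tr_Gmap_le/psd_iter_Gmap.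
Qed.

(** One bound for all iterates and all entries plays the part of a norm bound on the powers of
    [G]. *)
Definition orbit_bounded X :=
  exists B, forall n i j, `|iter n G X i j| <= B.

Lemma orbit_bounded_psd X : psd X -> orbit_bounded X.
Proof.
move=> pX; exists (\tr X) => n i j; apply: le_trans (tr_iter_Gmap_le n pX).
exact/psd_norm_le_tr/psd_iter_Gmap.
Qed.

Lemma orbit_boundedD X Y :
  orbit_bounded X -> orbit_bounded Y -> orbit_bounded (X + Y).
Proof.
move=> [B hB] [B' hB']; exists (B + B') => n i j.
by rewrite iter_GmapD mxDE (le_trans (ler_normD _ _)) // lerD.
Qed.

Lemma orbit_boundedZ a X : orbit_bounded X -> orbit_bounded (a *: X).
Proof.
move=> [B hB]; exists (`|a| * B) => n i j.
by rewrite iter_GmapZ mxZE normrM ler_wpM2l.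
Qed.

(** Matrices with bounded orbit form a subspace. It contains the positive rank-one matrices, hence
    by polarization every [u *m adj v], in particular the matrix units. *)
Lemma orbit_boundedT X : orbit_bounded X.
Proof.
have b0 : orbit_bounded 0 by apply/orbit_bounded_psd/psd0.
have b1 (u v : 'cV[C]_d) : orbit_bounded (u *m adj v).
  rewrite polarization; apply: orbit_boundedZ.
  have b c a : orbit_bounded (a *: ((u + c *: v) *m adj (u + c *: v))).
    exact/orbit_boundedZ/orbit_bounded_psd/psd_rank1.
  do 3?[apply: orbit_boundedD] => //.
  by rewrite -[_ *m _]scale1r; apply: b.
rewrite [X]matrix_sum_delta.
apply: big_ind => [||i _]; [exact: b0 | exact: orbit_boundedD |].
apply: big_ind => [||j _]; [exact: b0 | exact: orbit_boundedD |].
apply: orbit_boundedZ.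
have -> : delta_mx i j = ket C i *m adj (ket C j).
  apply/matrixP=> k l; rewrite [RHS]mxE big_ord1 adjE !mxE !eqxx !andbT rmorph_nat.
  by rewrite -natrM mulnb.
exact: b1.
Qed.

End Program.

(** * Archimedean limit arguments with powers of two *)

Section Limits.
Variable C : archiClosedFieldType.

Lemma norm_lt_pow2 (x : C) : exists N, forall n, (N <= n)%N -> `|x| < 2%:R ^+ n.
Proof.
exists (Num.bound x) => n Nn; have := archi_boundP (normr_ge0 x).
rewrite /Num.bound normr_id => /lt_le_trans; apply.
rewrite -natrX ler_nat (leq_trans Nn) // ltnW //; exact: ltn_expl.
Qed.

Lemma pow2_bounded_eq0 (x K : C) : (forall n, `|x| * 2%:R ^+ n <= K) -> x = 0.
Proof.
move=> h; apply/eqP/negPn/negP=> x0.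
have xp : 0 < `|x| by rewrite normr_gt0.
have [N /(_ N (leqnn N)) hN] := norm_lt_pow2 (K / `|x|).
have K0 : 0 <= K by apply: le_trans (h 0); rewrite mulr_ge0 ?exprn_ge0.
rewrite [X in X < _]ger0_norm ?divr_ge0 // in hN.
have := h N; rewrite mulrC -ler_pdivlMr // => /le_lt_trans/(_ hN).
by rewrite ltxx.
Qed.

(** Nonnegativity in [C] includes being real, so the target is [x = |x|]. An approximant [s >= 0]
    equals its own norm, so [x] and [|x|] are both within [|x - s|] of [s]. *)
Lemma pow2_approx_ge0 (x K : C) :
  (forall n, exists2 s, 0 <= s & `|x - s| * 2%:R ^+ n <= K) -> 0 <= x.
Proof.
move=> h; suff /eqP: x - `|x| = 0 by rewrite subr_eq0 => /eqP->.
apply: (@pow2_bounded_eq0 _ (K + K)) => n; have [s s0 hs] := h n.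
apply: le_trans (lerD hs hs); rewrite -mulrDl ler_wpM2r ?exprn_ge0 //.
have -> : x - `|x| = (x - s) + (s - `|x|) by ring.
apply: le_trans (ler_normD _ _) _; rewrite lerD2l.
by rewrite distrC -{1}(ger0_norm s0); apply: ler_dist_dist.
Qed.

End Limits.

(** * Invertibility of [I - G/2] and the solution of the fixed-point equation *)

Section Resolvent.
Variables (C : archiClosedFieldType) (d m : nat).
Variables (Ek : 'I_m -> seq 'M[C]_d) (M0 M1 : 'M[C]_d).
Hypothesis Ek_tp : forall k, trace_preserving (Ek k).
Hypothesis M01 : adj M0 *m M0 + adj M1 *m M1 = 1%:M.
Hypothesis m_gt0 : (0 < m)%N.
Local Notation G := (Gmap Ek M1).
Local Notation A := (1%:M - 2%:R^-1 *: Gmat Ek M1).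

Let bounded := orbit_boundedT Ek_tp M01 m_gt0.

(** Such an [X] satisfies [G^n X = 2^n X], which a bounded orbit allows only for [X = 0]. *)
Lemma half_Gmap_fix_eq0 X : X = 2%:R^-1 *: G X -> X = 0.
Proof.
move=> XE; have [B hB] := bounded X.
have iE n : iter n G X = 2%:R ^+ n *: X.
  elim: n => [|n IH]; first by rewrite expr0 scale1r.
  rewrite iterS IH linearZ /= [in RHS]XE [RHS]scalerA exprSr mulfK //.
  by rewrite pnatr_eq0.
apply/matrixP=> i j; rewrite [RHS]mxE.
apply: (@pow2_bounded_eq0 _ _ B) => n.
by have := hB n i j; rewrite iE mxZE normrM normrX normr_nat mulrC.
Qed.

Lemma resolvent_vec X : A *m vec X = vec (X - 2%:R^-1 *: G X).
Proof.
by rewrite mulmxBl mul1mx -scalemxAl Gmat_vec -scaleN1r -!vecZ -vecD scaleN1r.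
Qed.

Lemma resolvent_unit : A \in unitmx.
Proof.
(* Row-freeness speaks of row vectors, hence the passage to the transpose. *)
rewrite -unitmx_tr -row_free_unit; apply: inj_row_free => v vA.
have [X vX] := vec_surj v^T.
suff X0 : X = 0 by apply: trmx_inj; rewrite vX X0 vec0 trmx0.
apply/half_Gmap_fix_eq0/eqP; rewrite -subr_eq0; apply/eqP/vec_inj.
by rewrite -resolvent_vec -vX vec0 -[A]trmxK -trmx_mul vA trmx0.
Qed.

Section Solution.
Variables X0 X : 'M[C]_d.
Hypothesis XE : X = X0 + 2%:R^-1 *: G X.

Lemma Gseries_cvg : mx_converges (Gseries Ek M1 X0) X.
Proof.
have [B hB] := bounded X; move=> eps e0.
(* The error is the remainder, with entries at most [B / 2^(n+1)]. *)
have [N hN] := norm_lt_pow2 (B / eps); exists N => n Nn i j.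
have B0 : 0 <= B := le_trans (normr_ge0 _) (hB 0 i j).
have p0 : 0 < 2%:R ^+ n.+1 :> C by rewrite exprn_gt0 // ltr0n.
have := hN n.+1 (leqW Nn); rewrite ger0_norm ?divr_ge0 // ?ltW //.
rewrite ltr_pdivrMr // => h.
rewrite distrC {1}(Gseries_remainder n XE) mxDE addrC addKr mxZE.
rewrite normrM normrX normfV normr_nat exprVn mulrC ltr_pdivrMr // mulrC.
exact: le_lt_trans (hB n.+1 i j) h.
Qed.

Lemma psd_solution : psd X0 -> psd X.
Proof.
move=> pX0; split=> [|v].
  (* Self-adjointness comes from uniqueness: [adj X] solves the same equation, so [adj X - X] is
     fixed by [G/2]. *)
  apply/eqP; rewrite -subr_eq0; apply/eqP/half_Gmap_fix_eq0.
  rewrite linearB /= -adj_Gmap scalerBr {1 2}XE adjD adj_scale.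
  have [-> _] := pX0; rewrite fmorphV rmorph_nat opprD addrACA subrr add0r //.
have [B hB] := bounded X.
(* [K] bounds the form at [v] of every iterate of [X], uniformly in [n]. *)
pose K := \sum_i \sum_j `|v i 0| * B * `|v j 0|.
apply: (@pow2_approx_ge0 _ _ K) => n.
exists (qform (Gseries Ek M1 X0 n) v).
  apply: psd_qform; apply: psd_sum => i _; apply: psdZ; last exact: psd_iter_Gmap.
  by rewrite exprn_ge0 // invr_ge0 ler0n.
rewrite -/(qform X v) {1}(Gseries_remainder n XE) qformD addrC addKr qformZ.
rewrite normrM normrX normfV normr_nat.
have qK : `|qform (iter n.+1 G X) v| <= K.
  rewrite qformE (le_trans (ler_norm_sum _ _ _)) // ler_sum // => i _.
  rewrite (le_trans (ler_norm_sum _ _ _)) // ler_sum // => j _.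
  by rewrite !normrM norm_conjC ler_wpM2r // ler_wpM2l.
(* The remainder carries [2^-(n+1)] against the weight [2^n]; the leftover factor [1/2] is at most
   one. *)
apply: le_trans qK; rewrite mulrAC ler_piMl // exprS -mulrA -exprMn.
by rewrite mulVf ?pnatr_eq0 // expr1n mulr1 invf_le1 ?ler1n ?ltr0n.
Qed.

(* The remainder of the series is positive semidefinite too, hence so is the
   difference of [X] and each partial sum. *)
Lemma ker_Fstr_solution f (v : 'cV[C]_d) :
  psd X0 -> X *m v = 0 -> Fstr Ek M1 f X0 *m v = 0.
Proof.
move=> pX0 Xv; have pX := psd_solution pX0.
apply: psd_qform_eq0; first exact: psd_Fstr.
apply: qform_Fstr_eq0 => //.
have hp n : 0 <= 2%:R^-1 ^+ n :> C by rewrite exprn_ge0 // invr_ge0 ler0n.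
have : qform X v = 0 by rewrite /qform -mulmxA Xv mulmx0 mxE.
rewrite (Gseries_remainder (size f) XE) qformD => /eqP.
have pS i : 0 <= qform (2%:R^-1 ^+ i *: iter i G X0) v.
  exact/psd_qform/psdZ/psd_iter_Gmap.
rewrite {1}/Gseries qform_sum paddr_eq0 ?sumr_ge0 //; last first.
  exact/psd_qform/psdZ/psd_iter_Gmap.
case/andP=> /eqP/psumr_eq0P h _.
(* The last index of the partial sum is exactly [size f]. *)
have /eqP := h (fun i _ => pS i) ord_max isT.
rewrite qformZ mulf_eq0 expf_eq0 invr_eq0 pnatr_eq0 andbF => /eqP //.
Qed.

Lemma range_solution_reach :
  psd X0 -> forall v, (exists u, v = X *m u) <-> reach Ek M1 X0 v.
Proof.
move=> pX0 v; have pX := psd_solution pX0.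
have pF f : psd (Fstr Ek M1 f X0) by exact: psd_Fstr.
split=> [[u ->]|].
  have xE : vec X = invmx A *m vec X0.
    by rewrite -[LHS](mulKmx resolvent_unit) resolvent_vec {1}XE addrK.
  (* [S] is stable under [Gmat], which averages over the one-letter extensions of [f]; hence it is
     stable under [A], and then under [invmx A]. *)
  pose S x := lspan (fun w => exists f, w = vec (Fstr Ek M1 f X0)) x.
  have SG x : S x -> S (Gmat Ek M1 *m x).
    apply: (lspan_ind (P := fun x => S (Gmat Ek M1 *m x))).
    - by rewrite mulmx0; apply: lspan0.
    - by move=> a y Sy; rewrite -scalemxAr; apply: lspanZ.
    - by move=> y z Sy Sz; rewrite mulmxDr; apply: lspanD.
    - move=> _ [f ->]; rewrite Gmat_vec vecZ vec_sum; apply: lspanZ.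
      apply: lspan_sum => k _; apply: lspan_mem.
      by exists (rcons f k); rewrite Fstr_rcons.
  have SX : S (vec X).
    rewrite xE; apply: (invmx_stable (P := S)); first exact: resolvent_unit.
    - exact: lspan0.
    - by move=> *; apply: lspanZ.
    - by move=> *; apply: lspanD.
    - move=> x Sx; rewrite mulmxBl mul1mx -scalemxAl -scaleN1r.
      by apply: lspanD => //; do 2!apply: lspanZ; apply: SG.
    - by apply: lspan_mem; exists [::].
  (* Back from vectors to matrices: by induction on the span, each element of [S] is the
     vectorization of a matrix whose range lies in the reachable space. *)
  have [Y [/vec_inj -> //]] :
      exists Y, vec X = vec Y /\ forall w, reach Ek M1 X0 (Y *m w).
  move: SX; apply: (lspan_ind
    (P := fun x => exists Y, x = vec Y /\ forall w, reach Ek M1 X0 (Y *m w))).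
  - by exists 0; rewrite vec0; split=> // w; rewrite mul0mx; apply: lspan0.
  - move=> a _ [Y [-> hY]]; exists (a *: Y); rewrite vecZ; split=> // w.
    by rewrite -scalemxAl; apply/lspanZ/hY.
  - move=> _ _ [Y [-> hY]] [Z [-> hZ]]; exists (Y + Z); rewrite vecD.
    by split=> // w; rewrite mulmxDl; apply: lspanD; [apply: hY | apply: hZ].
  - move=> _ [f ->]; exists (Fstr Ek M1 f X0); split=> // w.
    apply: lspan_mem; exists f; apply/supp_range; first by case: (pF f).
    by exists w.
apply: lspan_range => u [f /supp_range]; case: (pF f) => hF _ /(_ hF) [w ->].
(* Since the kernel of [X] lies in that of [F_f X0], the latter factors through [X]. *)
have [Y ->] : exists Y, Fstr Ek M1 f X0 = X *m Y.
  apply: range_of_ker => //; first by case: pX.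
  by move=> t; apply: ker_Fstr_solution.
by exists (Y *m w); rewrite mulmxA.
Qed.

End Solution.
End Resolvent.

Lemma lspan_col (C : numClosedFieldType) d (X : 'M[C]_d) v :
  lspan (fun w => exists j, w = col j X) v <-> exists u, v = X *m u.
Proof.
split=> [|[u ->]].
  by apply: lspan_range => _ [j ->]; rewrite colE; exists (delta_mx j 0).
rewrite [u]matrix_sum_delta mulmx_sumr; apply: lspan_sum => j _.
rewrite big_ord1 -scalemxAr -colE; apply/lspanZ/lspan_mem.
by exists j.
Qed.

Theorem mainTheorem2 (C : archiClosedFieldType) (d m : nat)
  (Ek : 'I_m -> seq 'M[C]_d) (M0 M1 : 'M[C]_d) (rho0 : 'M[C]_d) :
  (0 < d)%N -> (0 < m)%N ->
  (forall k, trace_preserving (Ek k)) ->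
  adj M0 *m M0 + adj M1 *m M1 = 1%:M ->
  density rho0 ->
  let G := Gmat Ek M1 in
  let A := 1%:M - 2%:R^-1 *: G in
  let x := invmx A *m (kron rho0 (1%:M : 'M[C]_d) *m Phi C d) in
  let y := fun j : 'I_d =>
    castmx (muln1 d, erefl) (kron (1%:M : 'M[C]_d) (bra C j) *m x) in
  A \in unitmx /\
  (forall v, lspan (fun w => exists j, w = y j) v <-> reach Ek M1 rho0 v) /\
  exists rho : 'M[C]_d,
    mx_converges (Gseries Ek M1 rho0) rho /\
    x = kron rho (1%:M : 'M[C]_d) *m Phi C d /\
    (forall v, supp rho v <-> reach Ek M1 rho0 v).
Proof.
move=> _ m_gt0 tp M01 [p0 _] G A x y.
have Au : A \in unitmx := resolvent_unit tp M01 m_gt0.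
(* [rho] is read off from [x] instead of being built as a limit; [A x = vec rho0] then becomes the
   fixed-point equation, from which convergence follows. *)
have [rho xE] := vec_surj x.
have rE : rho = rho0 + 2%:R^-1 *: Gmap Ek M1 rho.
  apply/eqP; rewrite -subr_eq; apply/eqP/vec_inj.
  by rewrite -resolvent_vec -xE /x mulKVmx.
have rR := range_solution_reach tp M01 m_gt0 rE p0.
split=> //; split=> [v|].
  rewrite -rR -lspan_col.
  have yE j : y j = col j rho by rewrite /y xE bra_vec.
  by split; apply: lspan_sub => _ [j ->]; apply: lspan_mem; exists j.
exists rho; split; first exact: (Gseries_cvg tp M01 m_gt0 rE).
split=> // v; rewrite supp_range //.
by have [] := psd_solution tp M01 m_gt0 rE p0.
Qed.
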